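(* Let $m,k$ be positive integers, let $i\neq j$ be non-negative integers, and let $\delta\in\mathbb{F}_{2^{2m}}$. Then $$f(x)=x+\left(\mathrm{Tr}_m^{2m}(x)^k+\delta\right)^{2^i}+\left(\mathrm{Tr}_m^{2m}(x)^k+\delta\right)^{2^j}$$ is a permutation polynomial of $\mathbb{F}_{2^{2m}}$ and, writing $C=\delta^{2^i}+\delta^{2^{i+m}}+\delta^{2^j}+\delta^{2^{j+m}}$, its compositional inverse over $\mathbb{F}_{2^{2m}}$ is $$f^{-1}(x)=x+\left(\left(\mathrm{Tr}_m^{2m}(x)+C\right)^k+\delta\right)^{2^i}+\left(\left(\mathrm{Tr}_m^{2m}(x)+C\right)^k+\delta\right)^{2^j}.$$
   Context: $\mathrm{Tr}_m^{2m}(x)=x+x^{2^m}$ is the trace map from $\mathbb{F}_{2^{2m}}$ to $\mathbb{F}_{2^m}$. The compositional inverse of a permutation polynomial $F$ of a finite field $\mathbb{F}$ is the unique polynomial map $F^{-1}$ with $F(F^{-1}(x))=F^{-1}(F(x))=x$ for all $x\in\mathbb{F}$. *)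

(* Defs.v *)
From HB Require Import structures.
From mathcomp Require Import all_boot all_order all_algebra.

Set Implicit Arguments.
Unset Strict Implicit.
Unset Printing Implicit Defensive.

Import GRing.Theory.
Local Open Scope ring_scope.

Definition permutation_polynomial (F : finFieldType) (p : {poly F}) : Prop :=
  bijective (fun x : F => p.[x]).

(* The inverse is unique only as a map on F: as an element of {poly F}, q is
   determined modulo 'X^#|F| - 'X. *)
Definition compositional_inverse (F : finFieldType) (p q : {poly F}) : Prop :=
  (forall x : F, p.[q.[x]] = x) /\ (forall x : F, q.[p.[x]] = x).

(* The polynomial inducing the trace map from GF(2^(2m)) to its subfield
   GF(2^m), when #|F| = 2^(2m). *)
Definition trace_poly (F : finFieldType) (m : nat) : {poly F} :=
  'X + 'X^(2 ^ m).

(* Main.v *)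
(* Write q = 2^m and T(x) = x + x^q.  T maps F into the fixed field of x |-> x^q,
   and T vanishes on that field since the characteristic is 2.  Hence, for s in
   the fixed field, h(s) = (s^k + delta)^(2^i) + (s^k + delta)^(2^j) satisfies
   T(h(s)) = C independently of s.  As f(x) = x + h(T(x)) and
   g(x) = x + h(T(x) + C), this gives T(f(x)) = T(g(x)) = T(x) + C, so the two
   h-terms of a composite coincide and cancel. *)

Require Import Defs.
From HB Require Import structures.
From mathcomp Require Import all_boot all_order all_algebra.
From mathcomp Require Import finfield.

Set Implicit Arguments.
Unset Strict Implicit.
Unset Printing Implicit Defensive.

Import GRing.Theory.
Local Open Scope ring_scope.

Lemma exprD_pow2 (R : comNzRingType) (n : nat) (x y : R) :
  2 \in [pchar R] -> (x + y) ^+ (2 ^ n) = x ^+ (2 ^ n) + y ^+ (2 ^ n).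
Proof.
by move=> char2; apply: exprDn_pchar; rewrite (eq_pnat _ (pcharf_eq char2)) pnatX.
Qed.

Definition trace (F : nzRingType) (m : nat) (x : F) : F := x + x ^+ (2 ^ m).

(** Membership in the subfield GF(2^m) when [#|F|] is 2^(2m), put as an equation so that elements
    stay in [F]. *)
Definition frob_fixed (F : nzRingType) (m : nat) (x : F) : Prop := x ^+ (2 ^ m) = x.

Section Trace.

Variables (F : finFieldType) (m : nat).
Hypotheses (char2 : 2 \in [pchar F]) (cardF : #|F| = (2 ^ (2 * m))%N).

Local Notation tr := (@trace F m).
Local Notation fixed := (@frob_fixed F m).

Lemma traceD (x y : F) : tr (x + y) = tr x + tr y.
Proof. by rewrite /trace exprD_pow2 // addrACA. Qed.

(** Raising to the power 2^m swaps the two summands, as x^(2^(2m)) = x on [F]. *)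
Lemma frob_fixed_trace (x : F) : fixed (tr x).
Proof.
rewrite /frob_fixed /trace exprD_pow2 // -exprM -expnD addnn -mul2n -cardF.
by rewrite expf_card addrC.
Qed.

Lemma trace_eq0 (x : F) : fixed x -> tr x = 0.
Proof. by rewrite /trace => ->; apply: addrr_pchar2. Qed.

Lemma frob_fixedX (n : nat) (x : F) : fixed x -> fixed (x ^+ n).
Proof. by rewrite /frob_fixed exprAC => ->. Qed.

Lemma frob_fixedD (x y : F) : fixed x -> fixed y -> fixed (x + y).
Proof. by rewrite /frob_fixed exprD_pow2 // => -> ->. Qed.

(** The power splits additively, and its part [s ^+ (2 ^ n)] is still fixed, so the trace kills
    it. *)
Lemma trace_exprD (n : nat) (s d : F) :
  fixed s -> tr ((s + d) ^+ (2 ^ n)) = tr (d ^+ (2 ^ n)).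
Proof. by move=> ss; rewrite exprD_pow2 // traceD trace_eq0 ?add0r //; apply: frob_fixedX. Qed.

Section Shift.

Variables (h : F -> F) (C : F).
Hypotheses (fixC : fixed C) (tr_h : forall s, fixed s -> tr (h s) = C).

Lemma shiftK : cancel (fun x => x + h (tr x)) (fun x => x + h (tr x + C)).
Proof.
move=> x /=; have sx := frob_fixed_trace x.
(* The first cancellation removes C + C inside the argument of [h], the second the two equal values
   of [h]. *)
by rewrite traceD tr_h // (addrK_pchar2 char2 C) (addrK_pchar2 char2).
Qed.

Lemma shiftVK : cancel (fun x => x + h (tr x + C)) (fun x => x + h (tr x)).
Proof.
(* [h] is now evaluated at [tr x + C], which must be fixed for [tr_h] to apply. *)
move=> x /=; have sx := frob_fixedD (frob_fixed_trace x) fixC.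
by rewrite traceD tr_h // (addrK_pchar2 char2).
Qed.

End Shift.

End Trace.

Theorem theorem12 (F : finFieldType) (m k i j : nat) (delta : F)
  (hm : (0 < m)%N) (hk : (0 < k)%N) (hij : i <> j)
  (hF : #|F| = (2 ^ (2 * m))%N) :
  let Tr := trace_poly F m in
  let f : {poly F} :=
    'X + (Tr ^+ k + delta%:P) ^+ (2 ^ i) + (Tr ^+ k + delta%:P) ^+ (2 ^ j) in
  let C : F :=
    delta ^+ (2 ^ i) + delta ^+ (2 ^ (i + m))
    + delta ^+ (2 ^ j) + delta ^+ (2 ^ (j + m)) in
  let g : {poly F} :=
    'X + ((Tr + C%:P) ^+ k + delta%:P) ^+ (2 ^ i)
       + ((Tr + C%:P) ^+ k + delta%:P) ^+ (2 ^ j) in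
  permutation_polynomial f /\ compositional_inverse f g.
Proof.
move=> Tr f C g.
have char2 : 2 \in [pchar F] by apply: (card_finPcharP hF).
pose tr := @trace F m.
pose h (s : F) := (s ^+ k + delta) ^+ (2 ^ i) + (s ^+ k + delta) ^+ (2 ^ j).
have fE x : f.[x] = x + h (tr x) by rewrite /f /Tr /trace_poly !hornerE.
have gE x : g.[x] = x + h (tr x + C) by rewrite /g /Tr /trace_poly !hornerE.
have CE : C = tr (delta ^+ (2 ^ i)) + tr (delta ^+ (2 ^ j)).
  (* Since 2^(i+m) = 2^i * 2^m, the four terms of [C] pair up into two traces. *)
  by rewrite /C /tr /trace -!exprM -!expnD !addrA.
have fixC : frob_fixed m C.
  by rewrite CE; apply: (frob_fixedD char2); apply: frob_fixed_trace.
have tr_h s : frob_fixed m s -> tr (h s) = C.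
  move=> ss; have sk := frob_fixedX k ss.
  by rewrite /h /tr traceD // !trace_exprD // CE.
have fK x : g.[f.[x]] = x by rewrite fE gE; apply: shiftK.
have gK x : f.[g.[x]] = x by rewrite fE gE; apply: shiftVK.
by split; [exists (fun x => g.[x]) | split].
Qed.
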